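(* Let $m$ and $n$ be positive integers, $u=n(n+1)$ and $v=\frac{n+1}{n^2}$. Then \[ 4m\,\Sigma n^{2m-1}=\sum_{j=1}^m\binom{2m}{2j-1}P^{\rm Inv}_{j-1}(u)B_{2m-2j+1}+\sum_{j=1}^m\binom{2m}{2j}Q^{\rm Inv}_j(u)B_{2m-2j}, \] \[ (4m+2)\Sigma n^{2m}=\sum_{j=1}^{m+1}\binom{2m+1}{2j-1}(2n+1)\mathcal{P}^{\rm Inv}_{j-1}(u)B_{2m-2j+2}+\sum_{j=1}^m\binom{2m+1}{2j}(2n+1)\mathcal{Q}^{\rm Inv}_j(u)B_{2m-2j+1}, \] \[ 4m\,\Sigma^2 n^{2m-1}=\sum_{j=1}^m\binom{2m}{2j-1}n^{2j-1}P^{\rm Inv}_{j-1}(v)B_{2m-2j+1}+\sum_{j=1}^m\binom{2m}{2j}\Bigl((n+2)n^{2j-1}\mathcal{Q}^{\rm Inv}_j(v)+2\,\Sigma n^{2j}\Bigr)B_{2m-2j}, \] \[ (4m+2)\Sigma^2 n^{2m}=\sum_{j=1}^{m+1}\binom{2m+1}{2j-1}\Bigl(n^{2j-1}P^{\rm Inv}_{j-1}(v)+2\,\Sigma n^{2j-1}\Bigr)B_{2m-2j+2}+\sum_{j=1}^m\binom{2m+1}{2j}(n+2)n^{2j-1}\mathcal{Q}^{\rm Inv}_j(v)B_{2m-2j+1}. \]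
   Context: $\Sigma n^m=1^m+\cdots+n^m$ and $\Sigma^2 n^m=\Sigma 1^m+\Sigma 2^m+\cdots+\Sigma n^m$. Bernoulli numbers: $B_0=1$, $B_k=-\frac1{k+1}\sum_{j=0}^{k-1}\binom{k+1}{j}B_j$ ($B_1=-1/2$). For integers $n,k\ge0$: $T_k(n)=\binom{n+k+1}{2k+1}+\binom{n+k}{2k+1}$, $U_k(n)=\binom{n+k}{2k}+\binom{n+k-1}{2k}$ for $k\ge1$ and $U_0(n)=2$. Polynomials: $P_n(x)=\sum_{k=0}^nT_k(n)x^k$, $Q_n(x)=\sum_{k=0}^nU_k(n)x^k$, $\mathcal{P}_n(x)=\sum_{k=0}^n\binom{n+k}{2k}x^k$, $\mathcal{Q}_n(x)=\sum_{k=1}^n\binom{n+k-1}{2k-1}x^k$ for $n\ge1$ (and $\mathcal{Q}_0=1$). For each of these, $F^{\rm Inv}_n(x)=x^nF_n(1/x)$, e.g. $P^{\rm Inv}_n(x)=\sum_{k=0}^nT_k(n)x^{n-k}$. *)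

(* Defs.v *)
From mathcomp Require Import all_boot all_order all_algebra.

Set Implicit Arguments.
Unset Strict Implicit.
Unset Printing Implicit Defensive.

Import Order.TTheory GRing.Theory Num.Theory.

Local Open Scope ring_scope.

Definition power_sum (n m : nat) : nat := (\sum_(1 <= i < n.+1) i ^ m)%N.

Definition power_sum2 (n m : nat) : nat :=
  (\sum_(1 <= i < n.+1) power_sum i m)%N.

(* [:: B_0; ...; B_k]; the recurrence for B_k needs all earlier values.
   The recurrence itself is bernoulli_numE. *)
Fixpoint bernoulli_seq (k : nat) : seq rat :=
  if k is k'.+1 then
    let s := bernoulli_seq k' in
    rcons s (- (1 / k'.+2%:R) * \sum_(0 <= j < k'.+1) 'C(k'.+2, j)%:R * s`_j)
  else [:: 1].

Definition bernoulli_num (k : nat) : rat := (bernoulli_seq k)`_k.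

Lemma size_bernoulli_seq k : size (bernoulli_seq k) = k.+1.
Proof. by elim: k => //= k IHk; rewrite size_rcons IHk. Qed.

Lemma nth_bernoulli_seq k j :
  (j <= k)%N -> (bernoulli_seq k)`_j = bernoulli_num j.
Proof.
elim: k => [|k IHk]; first by rewrite leqn0 => /eqP->.
rewrite leq_eqVlt => /predU1P[-> //|]; rewrite ltnS => le_jk.
by rewrite /= nth_rcons size_bernoulli_seq ltnS le_jk IHk.
Qed.

Lemma bernoulli_num0 : bernoulli_num 0 = 1.
Proof. by []. Qed.

Lemma bernoulli_numE k : (0 < k)%N ->
  bernoulli_num k =
    - (1 / k.+1%:R) * \sum_(0 <= j < k) 'C(k.+1, j)%:R * bernoulli_num j.
Proof.
case: k => // k _; rewrite {1}/bernoulli_num /=.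
rewrite nth_rcons size_bernoulli_seq ltnn eqxx; congr (_ * _).
apply: eq_big_nat => j /andP[_ lt_jk].
by rewrite nth_bernoulli_seq.
Qed.

Lemma bernoulli_num1 : bernoulli_num 1 = - (1 / 2%:R).
Proof. by rewrite bernoulli_numE // big_nat1 bernoulli_num0 !mulr1. Qed.

Definition coefT (k n : nat) : nat :=
  ('C(n + k + 1, 2 * k + 1) + 'C(n + k, 2 * k + 1))%N.

Definition coefU (k n : nat) : nat :=
  if k == 0%N then 2%N else ('C(n + k, 2 * k) + 'C(n + k - 1, 2 * k))%N.

(* romP, romQ are the roman P_n, Q_n; calP, calQ the calligraphic ones. *)
Definition romP (n : nat) : {poly rat} :=
  \sum_(0 <= k < n.+1) (coefT k n)%:R *: 'X^k.

Definition romQ (n : nat) : {poly rat} :=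
  \sum_(0 <= k < n.+1) (coefU k n)%:R *: 'X^k.

Definition calP (n : nat) : {poly rat} :=
  \sum_(0 <= k < n.+1) 'C(n + k, 2 * k)%:R *: 'X^k.

Definition calQ (n : nat) : {poly rat} :=
  if n == 0%N then 1
  else \sum_(1 <= k < n.+1) 'C(n + k - 1, 2 * k - 1)%:R *: 'X^k.

(* Only meaningful for x != 0, where it is the reversed polynomial sum
   (see polyInv_sum); at x = 0 the convention 0^-1 = 0 makes it differ. *)
Definition polyInv (F : nat -> {poly rat}) (n : nat) (x : rat) : rat :=
  x ^+ n * (F n).[1 / x].

Lemma polyInv_sum (F : nat -> {poly rat}) (c : nat -> rat) (a n : nat) x :
  x != 0 -> F n = \sum_(a <= k < n.+1) c k *: 'X^k ->
  polyInv F n x = \sum_(a <= k < n.+1) c k * x ^+ (n - k).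
Proof.
move=> x0 FE; rewrite /polyInv FE horner_sum mulr_sumr.
apply: eq_big_nat => k /andP[_]; rewrite ltnS => le_kn.
rewrite hornerZ hornerXn div1r mulrCA exprVn -[in LHS](subnK le_kn) exprD.
by rewrite mulfK // expf_neq0.
Qed.

(* Main.v *)
Require Import Defs.
From mathcomp Require Import all_boot all_order all_algebra.
From mathcomp Require Import ring zify.

Set Implicit Arguments.
Unset Strict Implicit.
Unset Printing Implicit Defensive.

Import Order.TTheory GRing.Theory Num.Theory.

Local Open Scope ring_scope.

(** If a - b = 1 and a b = x, then the four reversed polynomials at x are, up
    to the factor a + b, the sums and differences a^i +- b^i.  For x = u take
    (a, b) = (n + 1, n); for x = v take (a, b) = ((n + 1) / n, 1 / n), so that
    after scaling by n^i one gets (n + 1)^i - 1.  The two sums over j then merge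
    into one sum over i, which is a combination of values of
    B_K(X) - B_K, where B_K(X) is the Bernoulli polynomial, and
    the difference equation B_K(X + 1) - B_K(X) = K X^(K - 1) and the
    reflection B_K(-X) = (-1)^K B_K(X + 1) finish the proof. *)

(** * Reversed polynomials *)

(** For nonzero x this is [polyInv calP j x]; being free of division, it satisfies the recurrences
    below at every x. *)
Definition sumP (x : rat) (j : nat) : rat :=
  \sum_(k < j.+1) 'C(j + k, 2 * k)%:R * x ^+ (j - k).

(* The summation index is shifted by one with respect to [calQ]. *)
Definition sumQ (x : rat) (j : nat) : rat :=
  \sum_(k < j) 'C(j + k, 2 * k + 1)%:R * x ^+ (j - k.+1).

(** Pascal's rule on C(j + 1 + k, 2k): the part with lower index 2k yields [x * sumP x j], the part
    with 2k - 1 yields [sumQ x j.+1] after a shift of k. *)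
Lemma sumP_rec x j : sumP x j.+1 = x * sumP x j + sumQ x j.+1.
Proof.
have pascal k : 'C(j.+1 + k, 2 * k)%:R =
    'C(j + k, 2 * k)%:R + (if k is k'.+1 then 'C(j + k, 2 * k' + 1) else 0)%:R
    :> rat.
  case: k => [|k]; first by rewrite !muln0 !bin0 addr0.
  have -> : (2 * k.+1 = (2 * k + 1).+1)%N by lia.
  by rewrite addSn binS natrD.
rewrite {1}/sumP; under eq_bigr do rewrite pascal mulrDl.
rewrite big_split /=; congr (_ + _).
  rewrite big_ord_recr /= bin_small ?mul0r ?addr0; last by lia.
  rewrite /sumP mulr_sumr; apply: eq_bigr => k _.
  by rewrite subSn ?leq_ord // exprS mulrCA.
rewrite big_ord_recl /= mul0r add0r; apply: eq_bigr => k _.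
by rewrite /bump /= add1n addSnnS subSS.
Qed.

Lemma sumQ_rec x j : sumQ x j.+1 = x * sumQ x j + sumP x j.
Proof.
rewrite {1}/sumQ; under eq_bigr do rewrite addSn addn1 binS natrD mulrDl subSS.
rewrite big_split /=; congr (_ + _).
rewrite big_ord_recr /= bin_small ?mul0r ?addr0; last by lia.
rewrite /sumQ mulr_sumr; apply: eq_bigr => k _.
by rewrite mulrCA -exprS subnSK // addn1.
Qed.

Section ClosedForms.

Variables (a b : rat).
Hypothesis ab1 : a - b = 1.

(** Induction through the two recurrences: since b + 1 = a, one has ab a^i + a^(i+1) = a^(i+2) and
    ab b^i - b^(i+1) = b^(i+2). *)
Lemma sumPQ_closed j :
  (a + b) * sumP (a * b) j = a ^+ (2 * j + 1) + b ^+ (2 * j + 1) /\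
  (a + b) * sumQ (a * b) j = a ^+ (2 * j) - b ^+ (2 * j).
Proof.
have -> : a = b + 1 by rewrite -ab1 addrC subrK.
elim: j => [|j [IHp IHq]].
  rewrite /sumP /sumQ big_ord1 big_ord0 muln0 !bin0 !expr0 add0n !expr1.
  by split; ring.
(* Proved first, because [sumP_rec] involves [sumQ] at [j.+1]. *)
have Qj : (b + 1 + b) * sumQ ((b + 1) * b) j.+1 =
    (b + 1) ^+ (2 * j.+1) - b ^+ (2 * j.+1).
  rewrite sumQ_rec mulrDr mulrCA IHp IHq !mulnS !exprD.
  by rewrite !expr1 !expr2; ring.
split=> //; rewrite sumP_rec mulrDr mulrCA IHp Qj mulnS !exprD !expr1 !expr2.
by ring.
Qed.

Hypothesis ab_neq0 : a * b != 0.

Lemma calP_closed j :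
  (a + b) * polyInv calP j (a * b) = a ^+ (2 * j + 1) + b ^+ (2 * j + 1).
Proof.
have [<- _] := sumPQ_closed j; congr (_ * _).
by rewrite (polyInv_sum ab_neq0 erefl) big_mkord.
Qed.

Lemma calQ_closed j : (0 < j)%N ->
  (a + b) * polyInv calQ j (a * b) = a ^+ (2 * j) - b ^+ (2 * j).
Proof.
move=> j_gt0; have [_ <-] := sumPQ_closed j; congr (_ * _).
have calQE : calQ j =
    \sum_(1 <= k < j.+1) 'C(j + k - 1, 2 * k - 1)%:R *: 'X^k.
  by rewrite /calQ; case: j j_gt0.
rewrite (polyInv_sum ab_neq0 calQE) big_add1 big_mkord /=.
by apply: eq_bigr => k _; congr ('C(_, _)%:R * _); lia.
Qed.

Hypothesis addab_neq0 : a + b != 0.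

(** The two binomials in T_k give one [sumQ] each, and a^(2j+2) - b^(2j+2) + ab (a^(2j) - b^(2j)) is
    divisible by a + b. *)
Lemma romP_closed j :
  polyInv romP j (a * b) = a ^+ (2 * j + 1) - b ^+ (2 * j + 1).
Proof.
have romPE : polyInv romP j (a * b) = sumQ (a * b) j.+1 + a * b * sumQ (a * b) j.
  rewrite (polyInv_sum ab_neq0 erefl) big_mkord /coefT.
  under eq_bigr do rewrite natrD mulrDl.
  rewrite big_split /=; congr (_ + _).
    by apply: eq_bigr => k _; rewrite addn1 addSn subSS.
  rewrite big_ord_recr /= bin_small ?mul0r ?addr0; last by lia.
  rewrite /sumQ mulr_sumr; apply: eq_bigr => k _.
  by rewrite mulrCA -exprS subnSK.
apply: (mulfI addab_neq0); rewrite romPE mulrDr mulrCA.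
have [_ ->] := sumPQ_closed j; have [_ ->] := sumPQ_closed j.+1.
by rewrite mulnS !exprD !expr1 !expr2; ring.
Qed.

Lemma romQ_closed j : (0 < j)%N ->
  polyInv romQ j (a * b) = a ^+ (2 * j) + b ^+ (2 * j).
Proof.
case: j => // j _.
have romQE : polyInv romQ j.+1 (a * b) = sumP (a * b) j.+1 + a * b * sumP (a * b) j.
  rewrite (polyInv_sum ab_neq0 erefl) big_mkord.
  (* The special value U_0 = 2 agrees with the binomial formula at k = 0. *)
  have coefUE k : (coefU k j.+1)%:R =
      'C(j.+1 + k, 2 * k)%:R + 'C(j + k, 2 * k)%:R :> rat.
    rewrite -natrD /coefU; case: eqP => [->|_]; first by rewrite !muln0 !bin0.
    by rewrite addSn subn1.
  under eq_bigr do rewrite coefUE mulrDl.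
  rewrite big_split /=; congr (_ + _).
  rewrite big_ord_recr /= bin_small ?mul0r ?addr0; last by lia.
  rewrite /sumP mulr_sumr; apply: eq_bigr => k _.
  by rewrite subSn ?leq_ord // exprS mulrCA.
apply: (mulfI addab_neq0); rewrite romQE mulrDr mulrCA.
have [-> _] := sumPQ_closed j; have [-> _] := sumPQ_closed j.+1.
by rewrite mulnS !exprD !expr1 !expr2; ring.
Qed.

End ClosedForms.

(** * Bernoulli polynomials *)

Lemma deriv_eq0_polyC (p : {poly rat}) : p^`() = 0 -> p = (p.[0])%:P.
Proof.
move=> dp; apply/polyP => -[|i]; rewrite coefC /= ?horner_coef0 //.
have /eqP := coef_deriv p i; rewrite dp coef0 eq_sym mulrn_eq0 /=.
by move/eqP.
Qed.

Definition bernoulli_poly (k : nat) : {poly rat} :=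
  \poly_(i < k.+1) ('C(k, i)%:R * bernoulli_num (k - i)).

Lemma coef_bernoulli_poly k i :
  (bernoulli_poly k)`_i = 'C(k, i)%:R * bernoulli_num (k - i).
Proof. by rewrite coef_poly ltnS; case: leqP => // /bin_small ->; rewrite mul0r. Qed.

Lemma bernoulli_poly0 : bernoulli_poly 0 = 1%:P.
Proof. by apply/polyP => -[|i]; rewrite coef_bernoulli_poly coefC ?mul0r. Qed.

Lemma deriv_bernoulli_poly k :
  (bernoulli_poly k.+1)^`() = k.+1%:R *: bernoulli_poly k.
Proof.
apply/polyP => i; rewrite coef_deriv coefZ !coef_bernoulli_poly subSS.
by rewrite mulrA -natrM mul_bin_diag -mulrnAl -mulr_natl -natrM.
Qed.

Lemma bernoulli_poly_at0 k : (bernoulli_poly k).[0] = bernoulli_num k.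
Proof. by rewrite horner_coef0 coef_bernoulli_poly bin0 subn0 mul1r. Qed.

(** After reversing the sum, the recurrence defining B_(k-1) cancels every term except B_k. It fails
    at k = 1, where B_1(1) = 1/2. *)
Lemma bernoulli_poly_at1 k : (1 < k)%N ->
  (bernoulli_poly k).[1] = bernoulli_num k.
Proof.
case: k => [|[|k]] // _; rewrite horner_poly.
under eq_bigr do rewrite expr1n mulr1.
rewrite (reindex_inj rev_ord_inj) /=.
under eq_bigr => i _ do
  rewrite subSS bin_sub ?subKn ?leq_ord //.
rewrite !big_ord_recr /= (@bernoulli_numE k.+1) // binn.
rewrite (_ : 'C(k.+2, k.+1) = k.+2); last by rewrite -bin_sub // subSnn bin1.
rewrite div1r big_mkord big_ord_recr /= mulrA mulrN mulfV ?pnatr_eq0 //.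
by rewrite mulN1r subrr add0r mul1r.
Qed.

(** By induction both sides have the same derivative, so it remains to compare them at 0. There
    B_k(1) = B_k(0) settles all degrees but 1, which is computed. *)
Lemma bernoulli_poly_shift k :
  bernoulli_poly k \Po ('X + 1) - bernoulli_poly k = k%:R *: 'X^(k.-1).
Proof.
elim: k => [|k IHk].
  by rewrite scale0r bernoulli_poly0 comp_polyC subrr.
apply/subr0_eq; rewrite [LHS]deriv_eq0_polyC.
  rewrite !hornerE horner_comp !hornerE /= !bernoulli_poly_at0.
  case: k {IHk} => [|k]; last by rewrite bernoulli_poly_at1 // subrr expr0n mulr0 subr0.
  by rewrite horner_poly !big_ord_recr big_ord0 /= bernoulli_num1 expr0; apply/polyP.
rewrite !derivB derivZ derivXn deriv_comp derivD derivX -polyC1 derivC addr0.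
rewrite mulr1 deriv_bernoulli_poly comp_polyZ -scalerBr polyC1 IHk.
by rewrite scaler_nat subrr.
Qed.

Lemma bernoulli_poly_reflect_poly k :
  bernoulli_poly k \Po (1 - 'X) = (-1) ^+ k *: bernoulli_poly k.
Proof.
pose r k := bernoulli_poly k \Po (1 - 'X) - (-1) ^+ k *: bernoulli_poly k.
(* The defect [r] inherits the derivative rule up to sign, so [r k = 0] makes [r k.+1] constant. *)
have dr i : (r i.+1)^`() = - i.+1%:R *: r i.
  rewrite /r derivB derivZ deriv_comp derivB derivX -polyC1 derivC sub0r.
  rewrite !deriv_bernoulli_poly comp_polyZ exprS.
  rewrite mulN1r scaleNr mulrN1 scalerBr !scaleNr opprK.
  by rewrite opprK !scalerA mulrC.
apply/subr0_eq; rewrite -/(r k); elim: k => [|k IHk].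
  by rewrite /r scale1r bernoulli_poly0 comp_polyC subrr.
(* [r k.+1] is a constant c, so [r k.+2] is affine with slope - k.+2 c;
   it takes the same value at 0 and 1. *)
have rk1 : r k.+1 = (r k.+1).[0]%:P.
  by apply: deriv_eq0_polyC; rewrite dr IHk scaler0.
set c := (r k.+1).[0] in rk1.
have rk2 : r k.+2 + (k.+2%:R * c) *: 'X = (r k.+2 + (k.+2%:R * c) *: 'X).[0]%:P.
  apply: deriv_eq0_polyC; rewrite derivD derivZ derivX dr rk1.
  by rewrite alg_polyC scaleNr -mul_polyC -polyCM addNr.
(* For n = k + 2, r_n(0) and r_n(1) both equal (1 - (-1)^n) B_n because B_n(1) = B_n(0); hence the
   slope vanishes. *)
have := congr1 (horner^~ 1) rk2; rewrite hornerC !hornerD !hornerZ !hornerX.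
rewrite mulr0 addr0 mulr1 !hornerN !hornerZ !horner_comp !hornerE.
rewrite subrr !bernoulli_poly_at0 !bernoulli_poly_at1 //.
rewrite -[RHS]addr0 => /addrI/eqP; rewrite mulf_eq0 pnatr_eq0 /=.
by move/eqP => c0; rewrite rk1 c0.
Qed.

Lemma bernoulli_poly_reflect k x :
  (bernoulli_poly k).[- x] = (-1) ^+ k * (bernoulli_poly k).[x + 1].
Proof.
rewrite -hornerZ -bernoulli_poly_reflect_poly horner_comp !hornerE.
by congr (_.[_]); ring.
Qed.

(** * Bernoulli-weighted binomial sums *)

(** The common shape of the four right-hand sides, as a linear functional of the weight [w].
    Starting at i = 1 drops the constant term B_K. *)
Definition bernoulli_comb (K : nat) (w : nat -> rat) : rat :=
  \sum_(1 <= i < K.+1) 'C(K, i)%:R * w i * bernoulli_num (K - i).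

Lemma bernoulli_combD K w1 w2 :
  bernoulli_comb K (fun i => w1 i + w2 i) =
  bernoulli_comb K w1 + bernoulli_comb K w2.
Proof. by rewrite -big_split /=; apply: eq_bigr => i _; ring. Qed.

Lemma bernoulli_combZ K c w :
  bernoulli_comb K (fun i => c * w i) = c * bernoulli_comb K w.
Proof. by rewrite /bernoulli_comb mulr_sumr; apply: eq_bigr => i _; ring. Qed.

Lemma bernoulli_comb_sum K (r : seq nat) (w : nat -> nat -> rat) :
  bernoulli_comb K (fun i => \sum_(k <- r) w k i) =
  \sum_(k <- r) bernoulli_comb K (w k).
Proof.
rewrite /bernoulli_comb exchange_big /=; apply: eq_bigr => i _.
by rewrite mulr_sumr mulr_suml.
Qed.

Lemma bernoulli_comb_exp K x :
  bernoulli_comb K (fun i => x ^+ i) =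
  (bernoulli_poly K).[x] - bernoulli_num K.
Proof.
rewrite horner_poly -(big_mkord xpredT (fun i =>
  'C(K, i)%:R * bernoulli_num (K - i) * x ^+ i)) big_nat_recl //=.
rewrite bin0 subn0 mulr1 mul1r addrAC subrr add0r /bernoulli_comb big_add1 /=.
by apply: eq_bigr => i _; rewrite mulrAC.
Qed.

Lemma bernoulli_comb_expS K x :
  bernoulli_comb K (fun i => (x + 1) ^+ i) =
  bernoulli_comb K (fun i => x ^+ i) + K%:R * x ^+ K.-1.
Proof.
have := congr1 (horner^~ x) (bernoulli_poly_shift K).
rewrite hornerD hornerN horner_comp hornerZ hornerXn !hornerE => <-.
by rewrite !bernoulli_comb_exp; ring.
Qed.

Lemma bernoulli_comb_expN K x : (1 < K)%N ->
  bernoulli_comb K (fun i => (- x) ^+ i) =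
  (-1) ^+ K * bernoulli_comb K (fun i => (x + 1) ^+ i).
Proof.
(* Reflection at 0 gives B_K = (-1)^K B_K, so the subtracted constant follows the sign too. *)
move=> K_gt1; have := bernoulli_poly_reflect K 0.
rewrite oppr0 add0r bernoulli_poly_at0 bernoulli_poly_at1 // => BK.
by rewrite !bernoulli_comb_exp mulrBr -BK bernoulli_poly_reflect.
Qed.

(** * Power sums as Bernoulli-weighted sums *)

Lemma power_sumS n m : power_sum n.+1 m = (power_sum n m + n.+1 ^ m)%N.
Proof. by rewrite /power_sum big_nat_recr. Qed.

(** Faulhaber's formula: the shift rule telescopes, starting from B_K(1) - B_K = 0. *)
Lemma bernoulli_comb_power_sum K n : (1 < K)%N ->
  bernoulli_comb K (fun i => (n%:R + 1) ^+ i) =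
  K%:R * (power_sum n K.-1)%:R.
Proof.
move=> K_gt1; elim: n => [|n IHn].
  rewrite add0r bernoulli_comb_exp bernoulli_poly_at1 // subrr.
  by rewrite /power_sum big_geq // mulr0.
rewrite bernoulli_comb_expS -natr1 IHn power_sumS natrD natrX -natr1.
by rewrite mulrDr.
Qed.

(** The weight is (n + 1)^i + n^i when i and K have the same parity and (n + 1)^i - n^i otherwise,
    matching the closed forms. By reflection both halves contribute equally. *)
Lemma bernoulli_comb_sym K n : (1 < K)%N ->
  bernoulli_comb K (fun i => (n%:R + 1) ^+ i + (-1) ^+ K * (- n%:R) ^+ i) =
  2 * K%:R * (power_sum n K.-1)%:R.
Proof.
move=> K_gt1; rewrite bernoulli_combD bernoulli_combZ bernoulli_comb_expN //.
by rewrite mulrA -exprMn mulrNN mulr1 expr1n mul1r bernoulli_comb_power_sum //; ring.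
Qed.

(** Each k contributes 2K (1^(K-1) + ... + k^(K-1)) - K k^(K-1). The deficit, summed over k, is
    restored by (n + 1)^i, while the weight 1^i contributes B_K(1) - B_K = 0. *)
Lemma bernoulli_comb_sym2 K n : (1 < K)%N ->
  bernoulli_comb K (fun i => ((n%:R + 1) ^+ i + (-1) * 1 ^+ i) +
     \sum_(1 <= k < n.+1) (k%:R ^+ i + (-1) ^+ K * (- k%:R) ^+ i)) =
  2 * K%:R * (power_sum2 n K.-1)%:R.
Proof.
move=> K_gt1; rewrite !bernoulli_combD bernoulli_combZ bernoulli_comb_sum.
rewrite bernoulli_comb_power_sum //.
rewrite bernoulli_comb_exp bernoulli_poly_at1 // subrr mulr0 addr0.
have step k : bernoulli_comb K
      (fun i => k%:R ^+ i + (-1) ^+ K * (- k%:R) ^+ i) =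
    2 * K%:R * (power_sum k K.-1)%:R - K%:R * (k ^ K.-1)%:R.
  rewrite -bernoulli_comb_sym // !bernoulli_combD bernoulli_comb_expS natrX.
  by ring.
under eq_bigr do rewrite step.
rewrite big_split /= sumrN -!mulr_sumr -!natr_sum.
by rewrite addrCA subrr addr0.
Qed.

(** * Splitting a sum by the parity of its index *)

Lemma sum_odd_even (V : nmodType) (f : nat -> V) m :
  \sum_(1 <= j < m.+1) f (2 * j - 1)%N + \sum_(1 <= j < m.+1) f (2 * j)%N =
  \sum_(1 <= i < (2 * m).+1) f i.
Proof.
elim: m => [|m IHm]; first by rewrite !big_geq // addr0.
rewrite !(big_nat_recr m.+1) //= addrACA IHm mulnS add2n.
by rewrite !(big_nat_recr _.+1) //= addrA subn1.
Qed.

(** Stating the odd weights at [j.+1] avoids truncated subtraction in 2j - 1. *)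
Lemma bernoulli_comb_even m w w1 w2 :
  (forall j, w (2 * j + 1)%N = w1 j.+1) ->
  (forall j, (0 < j)%N -> w (2 * j)%N = w2 j) ->
  \sum_(1 <= j < m.+1)
     'C(2 * m, 2 * j - 1)%:R * w1 j * bernoulli_num (2 * m + 1 - 2 * j)
  + \sum_(1 <= j < m.+1) 'C(2 * m, 2 * j)%:R * w2 j * bernoulli_num (2 * m - 2 * j)
  = bernoulli_comb (2 * m) w.
Proof.
move=> w1E w2E; rewrite /bernoulli_comb -sum_odd_even; congr (_ + _).
  apply: eq_big_nat => -[//|j] _; rewrite -w1E.
  by congr (_ * w _ * bernoulli_num _); lia.
by apply: eq_big_nat => j /andP[j_gt0 _]; rewrite w2E.
Qed.

Lemma bernoulli_comb_odd m w w1 w2 :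
  (forall j, w (2 * j + 1)%N = w1 j.+1) ->
  (forall j, (0 < j)%N -> w (2 * j)%N = w2 j) ->
  \sum_(1 <= j < m.+2)
     'C(2 * m + 1, 2 * j - 1)%:R * w1 j * bernoulli_num (2 * m + 2 - 2 * j)
  + \sum_(1 <= j < m.+1)
     'C(2 * m + 1, 2 * j)%:R * w2 j * bernoulli_num (2 * m + 1 - 2 * j)
  = bernoulli_comb (2 * m + 1) w.
Proof.
move=> w1E w2E; rewrite /bernoulli_comb addn1.
(* Up to 2m + 1 there is one more odd index than even ones; this top term is split off on both
   sides. *)
rewrite (big_nat_recr (2 * m).+1) // -sum_odd_even.
rewrite (big_nat_recr m.+1) //= addrAC.
congr (_ + _ + _); last first.
- by rewrite -w1E; congr ('C(_, _)%:R * w _ * bernoulli_num _); lia.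
- by apply: eq_big_nat => j /andP[j_gt0 _]; rewrite w2E.
apply: eq_big_nat => -[//|j] _; rewrite -w1E.
by congr (_ * w _ * bernoulli_num _); lia.
Qed.

Theorem theorem5 (m n : nat) (hm : (0 < m)%N) (hn : (0 < n)%N) :
  let B := bernoulli_num in
  let u : rat := n%:R * (n%:R + 1) in
  let v : rat := (n%:R + 1) / n%:R ^+ 2 in
  [/\ (4 * m)%:R * (power_sum n (2 * m - 1))%:R =
        \sum_(1 <= j < m.+1)
          'C(2 * m, 2 * j - 1)%:R * polyInv romP (j - 1) u
            * B (2 * m + 1 - 2 * j)%N
        + \sum_(1 <= j < m.+1)
          'C(2 * m, 2 * j)%:R * polyInv romQ j u * B (2 * m - 2 * j)%N,
      (4 * m + 2)%:R * (power_sum n (2 * m))%:R =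
        \sum_(1 <= j < m.+2)
          'C(2 * m + 1, 2 * j - 1)%:R
            * ((2 * n + 1)%:R * polyInv calP (j - 1) u)
            * B (2 * m + 2 - 2 * j)%N
        + \sum_(1 <= j < m.+1)
          'C(2 * m + 1, 2 * j)%:R * ((2 * n + 1)%:R * polyInv calQ j u)
            * B (2 * m + 1 - 2 * j)%N,
      (4 * m)%:R * (power_sum2 n (2 * m - 1))%:R =
        \sum_(1 <= j < m.+1)
          'C(2 * m, 2 * j - 1)%:R
            * (n%:R ^+ (2 * j - 1) * polyInv romP (j - 1) v)
            * B (2 * m + 1 - 2 * j)%N
        + \sum_(1 <= j < m.+1)
          'C(2 * m, 2 * j)%:R
            * ((n + 2)%:R * n%:R ^+ (2 * j - 1) * polyInv calQ j v
               + 2 * (power_sum n (2 * j))%:R)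
            * B (2 * m - 2 * j)%N
    & (4 * m + 2)%:R * (power_sum2 n (2 * m))%:R =
        \sum_(1 <= j < m.+2)
          'C(2 * m + 1, 2 * j - 1)%:R
            * (n%:R ^+ (2 * j - 1) * polyInv romP (j - 1) v
               + 2 * (power_sum n (2 * j - 1))%:R)
            * B (2 * m + 2 - 2 * j)%N
        + \sum_(1 <= j < m.+1)
          'C(2 * m + 1, 2 * j)%:R
            * ((n + 2)%:R * n%:R ^+ (2 * j - 1) * polyInv calQ j v)
            * B (2 * m + 1 - 2 * j)%N].
Proof.
move=> B u v; rewrite /B {B}.
have n0 : n%:R != 0 :> rat by rewrite pnatr_eq0 -lt0n.
have n1 : n%:R + 1 != 0 :> rat by rewrite natr1 pnatr_eq0.
have uE : u = (n%:R + 1) * n%:R by rewrite /u mulrC.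
have u0 : (n%:R + 1) * n%:R != 0 :> rat by rewrite mulf_neq0.
have ud : n%:R + 1 - n%:R = 1 :> rat by ring.
have us : n%:R + 1 + n%:R = (2 * n + 1)%:R :> rat by rewrite natrD natrM; ring.
have us0 : n%:R + 1 + n%:R != 0 :> rat by rewrite us pnatr_eq0 addn1.
pose a : rat := (n%:R + 1) / n%:R; pose b : rat := n%:R^-1.
have vE : v = a * b by rewrite /v /a /b; field.
have v0 : a * b != 0 by rewrite !mulf_neq0 ?invr_neq0.
have vd : a - b = 1 by rewrite /a /b; field.
have vs : (n + 2)%:R = n%:R * (a + b) by rewrite natrD /a /b; field.
have vs0 : a + b != 0.
  have: (n + 2)%:R != 0 :> rat by rewrite pnatr_eq0 addn2.
  by rewrite vs mulf_eq0 negb_or => /andP[].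
have na i : n%:R ^+ i * a ^+ i = (n%:R + 1) ^+ i.
  by rewrite -exprMn /a mulrCA mulfV // mulr1.
have nb i : n%:R ^+ i * b ^+ i = 1 by rewrite -exprMn /b mulfV // expr1n.
have romPv j : n%:R ^+ (2 * j + 1) * polyInv romP j v = (n%:R + 1) ^+ (2 * j + 1) - 1.
  by rewrite vE romP_closed // mulrBr na nb.
(* As n + 2 = n (a + b), the prefactor is (a + b) n^(2j), just what the closed form and the scaling
   require. *)
have calQv j : (0 < j)%N -> (n + 2)%:R * n%:R ^+ (2 * j - 1) * polyInv calQ j v =
    (n%:R + 1) ^+ (2 * j) - 1.
  move=> j0; rewrite vs (mulrAC n%:R) -exprS -mulrA vE (calQ_closed vd v0 j0).
  by rewrite -subSn ?muln_gt0 // subn1 /= mulrBr na nb.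
have exprN_odd (x : rat) j : (- x) ^+ (2 * j + 1) = - x ^+ (2 * j + 1).
  by rewrite exprNn -signr_odd oddD oddM /= expr1 mulN1r.
have exprN_even (x : rat) j : (- x) ^+ (2 * j) = x ^+ (2 * j).
  by rewrite exprNn -signr_odd oddM /= expr0 mul1r.
have s0 : (-1) ^+ (2 * m) = 1 :> rat by rewrite -signr_odd oddM.
have s1 : (-1) ^+ (2 * m + 1) = -1 :> rat by rewrite exprN_odd expr1n.
have K0 : (1 < 2 * m)%N by lia.
have K1 : (1 < 2 * m + 1)%N by lia.
have pred0 : (2 * m - 1 = (2 * m).-1)%N by rewrite subn1.
have pred1 : (2 * m = (2 * m + 1).-1)%N by rewrite addn1.
have sub1 j : (2 * j.+1 - 1 = 2 * j + 1)%N by lia.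
have lhs0 : (4 * m)%:R = 2 * (2 * m)%:R :> rat by rewrite -natrM mulnA.
have lhs1 : (4 * m + 2)%:R = 2 * (2 * m + 1)%:R :> rat.
  by rewrite -natrM mulnDr mulnA.
split.
- rewrite pred0 lhs0 -bernoulli_comb_sym //; symmetry.
  apply: bernoulli_comb_even => [j|j j0].
    by rewrite subn1 /= uE romP_closed // s0 mul1r exprN_odd.
  by rewrite uE romQ_closed // s0 mul1r exprN_even.
- rewrite {1}pred1 lhs1 -bernoulli_comb_sym //; symmetry.
  apply: bernoulli_comb_odd => [j|j j0].
    by rewrite subn1 /= -us uE calP_closed // s1 mulN1r exprN_odd opprK.
  by rewrite -us uE calQ_closed // s1 mulN1r exprN_even.
- rewrite pred0 lhs0 -bernoulli_comb_sym2 //; symmetry.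
  apply: bernoulli_comb_even => [j|j j0]; rewrite s0 expr1n mulN1r.
    (* For even K the terms k^i and (-k)^i cancel at odd i; at even i they double, giving the extra
       power sum. For odd K the roles are swapped. *)
    rewrite sub1 subn1 /= romPv big1 ?addr0 // => k _.
    by rewrite exprN_odd mul1r subrr.
  rewrite calQv // /power_sum natr_sum mulr_sumr; congr (_ + _).
  by apply: eq_bigr => k _; rewrite exprN_even natrX; ring.
- rewrite {1}pred1 lhs1 -bernoulli_comb_sym2 //; symmetry.
  apply: bernoulli_comb_odd => [j|j j0]; rewrite s1 expr1n mulN1r.
    rewrite sub1 subn1 /= romPv /power_sum natr_sum mulr_sumr; congr (_ + _).
    by apply: eq_bigr => k _; rewrite exprN_odd natrX; ring.
  rewrite calQv // big1 ?addr0 // => k _.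
  by rewrite exprN_even mulN1r subrr.
Qed.
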